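(* Let $M$ be a structure, let $k,t\geq 2$ be integers, let $m\geq 1$, and let $\phi_1(x;y),\ldots,\phi_m(x;y)$ be $(k,1)$-semi-equations in $M$. Let $\Psi\colon\{0,1\}^m\to\{0,1\}$ be a function. Put $\alpha_k=\min\{k-1,2\}$. For finite sets $V\subseteq M^{|x|}$ and $W\subseteq M^{|y|}$, put $n=|V|+|W|$ and define $$E=\bigl\{(a,b)\in V\times W : \Psi\bigl(\mathbf 1_{M\models\phi_1(a;b)},\ldots,\mathbf 1_{M\models\phi_m(a;b)}\bigr)=1\bigr\}.$$ If $E$ is $K_{t,t}$-free, then $$|E|=O_{k,t,m}\bigl(n(1+\log(1+n))^{(m-1)\alpha_k}\bigr).$$ In particular, if $m=1$, then $|E|=O_{k,t}(n)$.
   Context: Let $M$ be a structure and $k\geq 2$. A partitioned formula $\phi(x;y)$ is a $(k,1)$-semi-equation in $M$ if, whenever $b_1,\ldots,b_k\in M^{|y|}$ and $M\models\exists x\bigwedge_{j=1}^k\phi(x;b_j)$, there are distinct $i,j\in\{1,\ldots,k\}$ such that $M\models\forall x(\phi(x;b_i)\rightarrow\phi(x;b_j))$. $\mathbf 1_{P}$ is $1$ if $P$ holds and $0$ otherwise. A relation $E\subseteq V\times W$ is $K_{t,t}$-free if there are no $A\subseteq V$, $A'\subseteq W$, both of cardinality $t$, with $A\times A'\subseteq E$. $O_\eta(\cdot)$ denotes a quantity bounded in absolute value by a constant depending only on the parameters $\eta$ times the argument. *)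

(* Defs.v *)
From mathcomp Require Import all_boot all_order all_algebra finmap.
From mathcomp Require Import all_classical all_reals all_analysis.
Set Implicit Arguments.
Unset Strict Implicit.
Unset Printing Implicit Defensive.

Local Open Scope classical_set_scope.

(** First-order logic with equality, single-sorted. *)

Record language := Language {
  func : Type;
  func_arity : func -> nat;
  relsym : Type;
  rel_arity : relsym -> nat }.

Record structure (L : language) := Structure {
  carrier :> Type;
  func_interp : forall f : func L, (func_arity f).-tuple carrier -> carrier;
  rel_interp : forall r : relsym L, (rel_arity r).-tuple carrier -> Prop }.

(** Terms and formulas whose free variables are among [v_0, ..., v_(n-1)].
    A quantifier binds the variable of index [0] of its body, so the free
    variable [v_i] of the quantified formula is [v_(i+1)] in the body. *)

Inductive term (L : language) (n : nat) : Type :=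
| Var of 'I_n
| App (f : func L) of ('I_(func_arity f) -> term L n).

Inductive formula (L : language) : nat -> Type :=
| FBot n : formula L n
| FEq n of term L n & term L n : formula L n
| FRel n (r : relsym L) of ('I_(rel_arity r) -> term L n) : formula L n
| FImp n of formula L n & formula L n : formula L n
| FAnd n of formula L n & formula L n : formula L n
| FOr n of formula L n & formula L n : formula L n
| FAll n of formula L n.+1 : formula L n
| FEx n of formula L n.+1 : formula L n.

Fixpoint eval (L : language) (M : structure L) (n : nat) (s : n.-tuple M)
    (u : term L n) : M :=
  match u with
  | Var i => tnth s i
  | App f args => func_interp [tuple eval s (args i) | i < func_arity f]
  end.

Fixpoint sat (L : language) (M : structure L) (n : nat) (phi : formula L n) :
    n.-tuple M -> Prop :=
  match phi in formula _ n return n.-tuple M -> Prop with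
  | FBot _ => fun=> False
  | FEq _ u v => fun s => eval s u = eval s v
  | FRel _ r args => fun s =>
      rel_interp [tuple eval s (args i) | i < rel_arity r]
  | FImp _ f g => fun s => sat f s -> sat g s
  | FAnd _ f g => fun s => sat f s /\ sat g s
  | FOr _ f g => fun s => sat f s \/ sat g s
  | FAll _ f => fun s => forall c : M, sat f [tuple of c :: s]
  | FEx _ f => fun s => exists c : M, sat f [tuple of c :: s]
  end.

(** A partitioned formula [phi(x;y)] with [|x| = p] and [|y| = q]: the first
    [p] variables form [x] and the last [q] form [y]. *)

Definition pformula (L : language) (p q : nat) := formula L (p + q).

Definition psat (L : language) (M : structure L) (p q : nat)
    (phi : pformula L p q) (a : p.-tuple M) (b : q.-tuple M) : Prop :=
  sat phi [tuple of a ++ b].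

Definition semi_equation (k : nat) (L : language) (M : structure L)
    (p q : nat) (phi : pformula L p q) : Prop :=
  forall b : 'I_k -> q.-tuple M,
    (exists a : p.-tuple M, forall j, psat phi a (b j)) ->
    exists i j : 'I_k, i != j /\
      (forall a : p.-tuple M, psat phi a (b i) -> psat phi a (b j)).

(** Cardinality of a finite set; the junk value on infinite sets is [0].
    The classical [choiceType] structure is what [fset_set] requires. *)

Definition ncard (T : Type) (A : set T) : nat :=
  #|` fset_set (A : set {classic T}) |.

Definition Ktt_free (t : nat) (T U : Type) (V : set T) (W : set U)
    (E : set (T * U)) : Prop :=
  ~ exists (A : set T) (A' : set U),
      [/\ A `<=` V, A' `<=` W, (A #= `I_t)%card, (A' #= `I_t)%card & A `*` A' `<=` E].

(** [0] and [1] are encoded as [false] and [true]. *)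

Definition bool_edges (L : language) (M : structure L) (p q m : nat)
    (phi : 'I_m -> pformula L p q) (Psi : m.-tuple bool -> bool)
    (V : set (p.-tuple M)) (W : set (q.-tuple M)) :
    set (p.-tuple M * q.-tuple M) :=
  [set ab | [/\ V ab.1, W ab.2 &
    Psi [tuple `[< psat (phi i) ab.1 ab.2 >] | i < m] = true]].

(* Main.v *)
Require Import Defs.
From mathcomp Require Import all_boot.
From mathcomp Require Import zify.
Set Implicit Arguments.
Unset Strict Implicit.
Unset Printing Implicit Defensive.

(** Splitting according to the truth values of the [phi_i] reduces [Psi] to a
    conjunction of [m] literals. For a single literal the count is linear: no
    point lies in [k] pairwise incomparable fibres, while [K_{t,t}]-freeness
    leaves fewer than [t] fibres above any fibre with at least [t] points; for a
    negated literal, [kt] incomparable fibres would put some point in [k] of them.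

    For the induction on [m], each literal on [V x W] is covered by bicliques of
    total size [O(n log^alpha n)], and the remaining [m-1] literals are counted
    inside each biclique. The covers come from repeated halving of a linear order
    of one side, and cost [O(log n)] per change of truth value along the order.
    If [k = 2] the fibres form a laminar family, so [V] has an order in which
    every fibre is convex, hence changes at most twice. In general [W] is ordered
    so that consecutive fibres have small symmetric difference in total: join each
    fibre to its largest proper subfibre. The fibres whose edge crosses size [h]
    are pairwise incomparable and have more than [h] points, so there are at most
    [(k-1)|V|/(h+1)] of them, and summing over [h] gives [O(|V| log n)]. *)

(** * Value changes along Boolean sequences *)

(** The default of [head] compares the last entry with itself, so only changes between neighbours
    count. *)
Fixpoint flips (v : seq bool) : nat :=
  if v is x :: v' then (x != head x v') + flips v' else 0.

Lemma flips_cat v1 v2 : flips v1 + flips v2 <= flips (v1 ++ v2).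
Proof.
elim: v1 => //= x [|y v1] /= IH; first by rewrite eqxx leq_addl.
by rewrite -!addnA leq_add2l addnA.
Qed.

(** A repeated value adds no change; a different one can add a change on each of its two sides. *)
Lemma flips_insert v1 y z v2 :
  flips (v1 ++ y :: z :: v2) <= flips (v1 ++ y :: v2) + 2 * (y != z).
Proof.
elim: v1 => [|x [|x' v1] /= IH] /=; first by case: y z v2 => [] [] [|[] v2] /=; lia.
  by lia.
by lia.
Qed.

Lemma flips0_constant v : flips v = 0 -> constant v.
Proof.
elim: v => //= x [|y v] //= IH /eqP; rewrite addn_eq0 eqb0 negbK.
by move=> /andP[/eqP-> /eqP/IH]; rewrite /= eqxx.
Qed.

Lemma flips_map_negb v : flips (map negb v) = flips v.
Proof.
elim: v => //= x [|y v] /= IH; first by case: x.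
by rewrite IH; case: x; case: y {IH}.
Qed.

Lemma flips_all v : all id v -> flips v = 0.
Proof. by elim: v => //= -[] // [|[] v] //= IH /IH. Qed.

Lemma flips_antitone v : pairwise (fun x y => y ==> x) v -> flips v <= head false v.
Proof.
elim: v => //= -[] [|[] v] //= IH /andP[_] /IH //; rewrite leqn0 => /eqP->//.
Qed.

(** * Fibres and incomparability *)

(** The trace of a [(k,1)]-semi-equation on finite sets of parameters. *)
Definition semi_eq (k : nat) (X Y : finType) (r : X -> Y -> bool) : Prop :=
  forall (b : 'I_k -> Y) (a : X), (forall j, r a (b j)) ->
  exists i j : 'I_k, i != j /\ forall a', r a' (b i) -> r a' (b j).

Definition fib (X Y : finType) (r : X -> Y -> bool) (A : {set X}) (b : Y) :=
  [set a in A | r a b].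

Definition incomparable (X Y : finType) (S : Y -> {set X}) (x y : Y) :=
  ~~ (S x \subset S y) && ~~ (S y \subset S x).

Lemma incomparable_sym (X Y : finType) (S : Y -> {set X}) :
  symmetric (incomparable S).
Proof. by move=> x y; rewrite /incomparable andbC. Qed.

(** Otherwise the first [k] members of [s] are parameters with the common point [a], so two of their
    fibres are nested, and nesting survives restriction to [A]. *)
Lemma semi_pairwise_incomparable k (X Y : finType) (r : X -> Y -> bool) A s a :
  semi_eq k r -> pairwise (incomparable (fib r A)) s -> all (r a) s -> size s < k.
Proof.
move=> rk incS /allP as_; rewrite ltnNge; apply/negP => ks.
have [|i [j [ij sub]]] := rk (fun j => tnth (in_tuple s) (widen_ord ks j)) a.
  by move=> j; apply: as_; rewrite mem_tnth.
pose y0 := tnth (in_tuple s) (widen_ord ks i).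
have {}sub : fib r A (nth y0 s i) \subset fib r A (nth y0 s j).
  apply/subsetP => a'; rewrite !inE => /andP[-> /=].
  by have := sub a'; rewrite !(tnth_nth y0).
have [ltis ltjs] : i < size s /\ j < size s by split; apply: (leq_trans _ ks).
have /(pairwiseP y0) inc := incS.
have: incomparable (fib r A) (nth y0 s i) (nth y0 s j).
  case: (ltngtP i j) => [lt|lt|/val_inj/eqP]; [exact: inc| |by rewrite (negPf ij)].
  by rewrite incomparable_sym; apply: inc.
by rewrite /incomparable sub.
Qed.

(** * Biclique covers *)

(** Rectangles may overlap, and their cost is the number of vertices, not of pairs: the edge bounds
    applied inside them are linear in the vertices. *)
Definition bicover (X Y : finType) (P : X -> Y -> bool) (A : {set X})
    (B : {set Y}) (w : nat) : Prop :=
  exists cv : seq ({set X} * {set Y}),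
  [/\ forall p, p \in cv -> [/\ p.1 \subset A, p.2 \subset B &
        forall a b, a \in p.1 -> b \in p.2 -> P a b],
      forall a b, a \in A -> b \in B -> P a b ->
        exists2 p, p \in cv & (a \in p.1) && (b \in p.2) &
      \sum_(p <- cv) (#|p.1| + #|p.2|) <= w].

Lemma bicover_leq (X Y : finType) (P : X -> Y -> bool) A B w w' :
  w <= w' -> bicover P A B w -> bicover P A B w'.
Proof. by move=> ww' [cv [cvP Pcv wcv]]; exists cv; split => //; apply: leq_trans ww'. Qed.

Lemma bicover_tr (X Y : finType) (P : X -> Y -> bool) A B w :
  bicover (fun b a => P a b) B A w -> bicover P A B w.
Proof.
move=> [cv [cvP Pcv wcv]]; exists [seq (p.2, p.1) | p <- cv]; split.
- by move=> _ /mapP[p /cvP[pB pA pP] ->] /=; split=> // a b ? ?; apply: pP.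
- move=> a b aA bB /(Pcv _ _ bB aA)[p pcv pab].
  by exists (p.2, p.1); [apply/mapP; exists p|rewrite andbC].
- by rewrite big_map; under eq_bigr do rewrite addnC.
Qed.

(** Rows constant on [s] form one rectangle; any other row flips at least once
    along [s], and this flip pays for its two recursive copies. *)
Lemma bicover_halving (X Y : finType) (P : X -> Y -> bool) (A : {set X}) D s :
  size s <= 2 ^ D ->
  bicover P A [set b in s]
    (size s * D.+1 + \sum_(a in A) (1 + 2 * D * flips (map (P a) s))).
Proof.
elim: D A s => [|D IH] A s sD.
  pose A1 := [set a in A | all (P a) s].
  exists [:: (A1, [set b in s])]; split.
  - move=> p; rewrite inE => /eqP-> /=; split=> //.
      by apply/subsetP => a; rewrite inE => /andP[].
    by move=> a b; rewrite !inE => /andP[_ /allP]; apply.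
  - move=> a b aA bs Pab; exists (A1, [set b in s]); first by rewrite inE.
    rewrite bs !inE aA /= andbT; case: s sD bs {A1} => [|c [|]] //= _.
    by rewrite !inE => /eqP <-; rewrite Pab.
  - rewrite big_seq1 /= muln1 addnC leq_add //; first by rewrite cardsE card_size.
    apply: (@leq_trans #|A|); last by rewrite -sum1_card leq_sum.
    by apply: subset_leq_card; apply/subsetP => a; rewrite inE => /andP[].
pose A1 := [set a in A | all (P a) s].
pose A2 := [set a in A | flips (map (P a) s) != 0].
set s1 := take (2 ^ D) s; set s2 := drop (2 ^ D) s.
have s12 : s = s1 ++ s2 by rewrite cat_take_drop.
have s1D : size s1 <= 2 ^ D by rewrite size_take_min geq_minl.
have s2D : size s2 <= 2 ^ D by rewrite size_drop leq_subLR addnn -mul2n -expnS.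
have [cv1 [cv1P Pcv1 wcv1]] := IH A2 s1 s1D.
have [cv2 [cv2P Pcv2 wcv2]] := IH A2 s2 s2D.
have A2A : A2 \subset A by apply/subsetP => a; rewrite inE => /andP[].
exists ((A1, [set b in s]) :: cv1 ++ cv2); split.
- move=> p; rewrite inE mem_cat => /or3P[/eqP-> /=|/cv1P|/cv2P].
  + split=> //; first by apply/subsetP => a; rewrite inE => /andP[].
    by move=> a b; rewrite !inE => /andP[_ /allP]; apply.
  + case=> pA ps pP; split=> //; first exact: subset_trans A2A.
    apply: (subset_trans ps); apply/subsetP => b; rewrite !inE s12 mem_cat => ->//.
  + case=> pA ps pP; split=> //; first exact: subset_trans A2A.
    apply: (subset_trans ps); apply/subsetP => b; rewrite !inE s12 mem_cat orbC => ->//.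
- move=> a b aA; rewrite inE => bs Pab.
  case a2 : (a \in A2); last first.
    exists (A1, [set b in s]); rewrite ?mem_head //= !inE bs aA /= andbT.
    move: a2; rewrite inE aA /= => /negbFE/eqP/flips0_constant/(constantP (P a b)) [x xs].
    have Px c : c \in s -> P a c = x.
      by move=> /(map_f (P a)); rewrite xs => /nseqP[].
    by apply/allP => c /Px ->; rewrite -(Px _ bs).
  move: bs; rewrite s12 mem_cat => /orP[bs1|bs2].
    have [|p pcv pab] := Pcv1 _ _ a2 (_ : b \in _) Pab; first by rewrite inE.
    by exists p => //; rewrite inE mem_cat pcv orbT.
  have [|p pcv pab] := Pcv2 _ _ a2 (_ : b \in _) Pab; first by rewrite inE.
  by exists p => //; rewrite inE !mem_cat pcv !orbT.
- rewrite big_cons big_cat /=.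
  have card_s : #|[set b in s]| <= size s by rewrite cardsE card_size.
  have sz : size s = size s1 + size s2 by rewrite {1}s12 size_cat.
  have : \sum_(a in A2) (1 + 2 * D * flips (map (P a) s1)) +
         \sum_(a in A2) (1 + 2 * D * flips (map (P a) s2)) + #|A1| <=
         \sum_(a in A) (1 + 2 * D.+1 * flips (map (P a) s)).
    rewrite -big_split /= [leqRHS](big_setID A2) /= leq_add //.
      rewrite (setIidPr A2A); apply: leq_sum => a; rewrite inE => /andP[_ f0].
      (* Since [f >= 1] and [f1 + f2 <= f], the two copies cost at most
         [2 + 2 * D * f <= 1 + 2 * D.+1 * f]. *)
      have := flips_cat (map (P a) s1) (map (P a) s2).
      rewrite -map_cat -s12 => le12.
      move: f0 le12; move: (flips _) (flips _) (flips _) => f f1 f2 f0 le12.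
      nia.
    apply: (@leq_trans #|A :\: A2|); last by rewrite -sum1_card leq_sum.
    apply: subset_leq_card; apply/subsetP => a.
    rewrite !inE => /andP[-> al] /=; rewrite andbT negbK.
    by rewrite flips_all // all_map.
  move: wcv1 wcv2 card_s; rewrite sz.
  move: (\sum_(p <- cv1) _) (\sum_(p <- cv2) _) (\sum_(a in A2) _).
  move=> w1 w2 S1; move: (\sum_(a in A2) _) (\sum_(a in A) _) => S2 S.
  rewrite [_ * D.+2]mulnS mulnDl; move: (size s1 * _) (size s2 * _) => c1 c2.
  by move: #|A1| #|[set b in s]| => *; lia.
Qed.

(** This spreads the length of an edge of the tree over the levels that it crosses. *)
Lemma leq_sum_interval m n N :
  n <= N -> n - m <= \sum_(i < N) ((m <= i) && (i < n)).
Proof.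
move=> nN; rewrite -{1}(minn_idPl nN) {nN}; elim: N => [|N IH].
  by rewrite minn0.
by rewrite big_ord_recr /=; move: (\sum_(_ < _) _) IH => w; lia.
Qed.

(** Each dyadic block of [2 ^ L] indices starting at [2 ^ L] has terms at most [M %/ 2 ^ L], so it
    contributes at most [M]. *)
Lemma sum_divn_dyadic M L : \sum_(h < 2 ^ L) M %/ h.+1 <= M * L.+1.
Proof.
elim: L => [|L IH]; first by rewrite big_ord1 divn1 muln1.
rewrite expnS mul2n -addnn big_split_ord /= mulnS addnC leq_add //.
apply: (@leq_trans (\sum_(i < 2 ^ L) M %/ 2 ^ L)).
  by apply: leq_sum => i _; apply: leq_div2l; rewrite ?expn_gt0 // -addnS leq_addr.
by rewrite sum_nat_const card_ord mulnC leq_divM.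
Qed.

(** * Orders with few flips *)

(** For [s] sorted by decreasing size, join each [b] to the largest subset of
    [S b] further down [s] (or to the empty set): [greedy S h s] lists the [b]
    whose edge crosses size [h]. *)
Fixpoint greedy (X Y : finType) (S : Y -> {set X}) (h : nat) (s : seq Y) : seq Y :=
  if s is b :: s' then
    if (h < #|S b|) && ~~ has (fun c => (h < #|S c|) && (S c \subset S b)) s'
    then b :: greedy S h s' else greedy S h s'
  else [::].

Lemma greedy_mem (X Y : finType) (S : Y -> {set X}) h s b :
  b \in greedy S h s -> (b \in s) && (h < #|S b|).
Proof.
elim: s => //= c s IH; case: ifP => [/andP[hc _]|_].
  by rewrite !inE => /predU1P[->|/IH/andP[-> ->]]; rewrite ?eqxx ?orbT.
by move=> /IH/andP[bs ->]; rewrite inE bs orbT.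
Qed.

(** The test keeps later listed sets from lying inside [S b]; the reverse inclusion would force
    equality, as sizes decrease. *)
Lemma greedy_incomparable (X Y : finType) (S : Y -> {set X}) h s :
  pairwise (fun b c => #|S c| <= #|S b|) s ->
  pairwise (incomparable S) (greedy S h s).
Proof.
elim: s => //= b s IH /andP[/allP bs /IH {}IH].
case: ifP => //= /andP[hb /hasPn nb]; rewrite IH andbT; apply/allP => c.
move=> /greedy_mem/andP[cs hc]; rewrite /incomparable.
have := nb _ cs; rewrite hc /= => /negP ncb; apply/andP; split; apply/negP => //.
move=> bc; apply: ncb; have := bs _ cs => /= cb.
by have /eqP-> : S b == S c by rewrite eqEcard bc.
Qed.

(** Double counting: each listed fibre has at least [h.+1] points, and each point of [A] lies in at
    most [k.-1] of these incomparable fibres. *)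
Lemma greedy_size k (X Y : finType) (r : X -> Y -> bool) (A : {set X}) h s : 0 < k ->
  semi_eq k r -> pairwise (fun b c => #|fib r A c| <= #|fib r A b|) s ->
  size (greedy (fib r A) h s) <= (k.-1 * #|A|) %/ h.+1.
Proof.
move=> k0 rk /(@greedy_incomparable _ _ _ h); set g := greedy _ _ _ => inc.
rewrite leq_divRL //; apply: (@leq_trans (\sum_(b <- g) #|fib r A b|)).
  rewrite -sum1_size big_distrl /= big_seq [leqRHS]big_seq; apply: leq_sum => b.
  by move=> /greedy_mem/andP[_]; rewrite mul1n.
have -> : \sum_(b <- g) #|fib r A b| = \sum_(a in A) count (r a) g.
  under eq_bigr => b _ do rewrite -sum1_card big_mkcond.
  under [RHS]eq_bigr => a _ do rewrite -sum1_count big_mkcond.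
  rewrite exchange_big /= [RHS]big_mkcond; apply: eq_bigr => a _.
  case aA : (a \in A); first by apply: eq_bigr => b _; rewrite inE aA.
  by rewrite big1 // => b _; rewrite inE aA.
rewrite mulnC -sum_nat_const; apply: leq_sum => a _.
rewrite -ltnS prednK // -size_filter.
apply: (semi_pairwise_incomparable rk _ (filter_all _ _)).
exact: subseq_pairwise (filter_subseq _ _) inc.
Qed.

Lemma sum_fib_diff (X Y : finType) (r : X -> Y -> bool) (A : {set X}) (b c : Y) :
  fib r A c \subset fib r A b ->
  \sum_(a in A) (r a c != r a b) = #|fib r A b| - #|fib r A c|.
Proof.
move=> cb; rewrite -cardsDS // -sum1_card big_mkcond [RHS]big_mkcond /=.
apply: eq_bigr => a _; rewrite !inE; case aA : (a \in A) => //=.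
by have /implyP := subsetP cb a; rewrite !inE aA /=; case: (r a b) (r a c) => [] [].
Qed.

(** The order is built by inserting each set right after a largest one of the
    subsets already present, so the total length is at most twice that of the
    tree underlying [greedy]. *)
Lemma exists_tour (X Y : finType) (r : X -> Y -> bool) (A : {set X}) s N :
  #|A| <= N -> pairwise (fun b c => #|fib r A c| <= #|fib r A b|) s ->
  exists2 s', perm_eq s' s &
    \sum_(a in A) flips (false :: map (r a) s') <=
    2 * \sum_(h < N) size (greedy (fib r A) h s).
Proof.
move=> AN; elim: s => [|b s IH] /=.
  by exists [::] => //; rewrite big1.
move=> /andP[_ /IH[s' ss' tour]] {IH}; set S := fib r A in tour *.
have SbN : #|S b| <= N.
  by apply: leq_trans AN; apply: subset_leq_card; apply/subsetP => a; rewrite inE => /andP[].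
(* Here [m] is the size of a largest subset of [S b] in [s], or [0]. At every level from [m] up to
   [#|S b| - 1] the element [b] joins the greedy list, which pays for its insertion. *)
suff [m [s'' ss'' tour'] new] : exists2 m,
      (exists2 s'', perm_eq s'' (b :: s') &
       \sum_(a in A) flips (false :: map (r a) s'') <=
       \sum_(a in A) flips (false :: map (r a) s') + 2 * (#|S b| - m)) &
    forall c, c \in s -> S c \subset S b -> #|S c| <= m.
  exists s''; first by rewrite (perm_trans ss'') // perm_cons.
  apply: (leq_trans tour'); rewrite addnC.
  apply: (leq_trans (leq_add (leqnn _) tour)); rewrite -mulnDr leq_mul2l /=.
  apply: (leq_trans (leq_add (leq_sum_interval m SbN) (leqnn _))).
  rewrite -big_split /=; apply: leq_sum => h _.
  case: andP => [[mh hb]|_]; last by case: ifP.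
  rewrite hb /= ifT //; apply/hasPn => c /new cm; rewrite negb_and -leqNgt.
  by case: (boolP (S c \subset S b)) => [/cm/leq_trans->|]; rewrite ?orbT.
(* [y] is the fibre just before the insertion point; the leading [false] plays the empty fibre when
   [s1] is empty. *)
have insert s1 s2 (y : X -> bool) :
    (forall a, last false (map (r a) s1) = y a) ->
    \sum_(a in A) flips (false :: map (r a) (s1 ++ b :: s2)) <=
    \sum_(a in A) flips (false :: map (r a) (s1 ++ s2)) + 2 * \sum_(a in A) (y a != r a b).
  move=> ys; rewrite big_distrr -big_split; apply: leq_sum => a _.
  rewrite -ys !map_cat -!cat_cons /=; move: (map _ s1) (map _ s2) => v1 v2.
  have := flips_insert (belast false v1) (last false v1) (r a b) v2.
  by rewrite -!cat_rcons -!lastI.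
have [/hasP[c0 c0s c0b]|/hasPn none] := boolP (has (fun c => S c \subset S b) s).
  pose below c := (c \in s) && (S c \subset S b).
  have below_c0 : below c0 by rewrite /below c0s.
  case: (arg_maxnP (fun c => #|S c|) below_c0) => c /andP[cs cb] cmax.
  exists #|S c|; last by move=> d ds db; apply: cmax; rewrite /below ds.
  have cs' : c \in s' by rewrite (perm_mem ss').
  case/path.splitPr: cs' ss' tour => s1 s2 ss' tour.
  exists (rcons s1 c ++ b :: s2).
    by rewrite (perm_catCA (rcons s1 c) [:: b] s2) /= cat_rcons perm_cons.
  rewrite -(sum_fib_diff cb).
  rewrite -(cat_rcons c s1 s2); apply: insert => a.
  by rewrite map_rcons last_rcons.
exists 0; last by move=> c /none/negP.
exists (b :: s'); first by rewrite perm_cons.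
have /= := insert [::] s' xpred0 (fun=> erefl).
have -> // : \sum_(a in A) (false != r a b) = #|S b| - 0.
rewrite subn0 -sum1_card big_mkcond [RHS]big_mkcond /=.
by apply: eq_bigr => a _; rewrite inE; case: (a \in A); case: (r a b).
Qed.

Lemma flips_map_eqb (T : Type) (f : T -> bool) c s :
  flips (map (fun x => f x == c) s) = flips (map f s).
Proof.
case: c; first by congr flips; apply: eq_map => x; rewrite eqb_id.
rewrite -[RHS]flips_map_negb -map_comp; congr flips.
by apply: eq_map => x /=; case: (f x).
Qed.

Lemma exists_sort_fib (X Y : finType) (r : X -> Y -> bool) (A : {set X}) (B : {set Y})
    (e : rel nat) : total e -> transitive e ->
  exists s, [/\ [set b in s] = B, size s = #|B| &
    pairwise (fun b c => e #|fib r A b| #|fib r A c|) s].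
Proof.
move=> e_total e_tr.
exists (sort (fun b c => e #|fib r A b| #|fib r A c|) (enum B)); split.
- by apply/setP => b; rewrite inE mem_sort mem_enum.
- by rewrite size_sort cardE.
- rewrite -sorted_pairwise; last by move=> x y z; apply: e_tr.
  by apply: sort_sorted => x y; apply: e_total.
Qed.

(** The tour of [B] has [O(k * #|A| * L)] flips in total, and halving charges [O(L)] for each: hence
    two logarithms. *)
Lemma semi_bicover k (X Y : finType) (r : X -> Y -> bool) c (A : {set X})
    (B : {set Y}) L :
  1 < k -> semi_eq k r -> #|A| + #|B| <= 2 ^ L ->
  bicover (fun a b => r a b == c) A B (4 * k * (#|A| + #|B|) * L.+1 ^ 2).
Proof.
move=> k1 rk ABL; have k0 := ltnW k1.
have geq_total : total geq by move=> x y; apply: leq_total.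
have geq_tr : transitive geq by move=> y x z /= xy yz; apply: leq_trans xy.
have [s [sB sizes sorts]] := exists_sort_fib r A B geq_total geq_tr.
have AL : #|A| <= 2 ^ L by apply: leq_trans ABL; apply: leq_addr.
have BL : #|B| <= 2 ^ L by apply: leq_trans ABL; apply: leq_addl.
have [s' ss' tour] := exists_tour AL sorts.
have s'B : [set b in s'] = B by rewrite -sB; apply/setP => b; rewrite !inE (perm_mem ss').
have sizes' : size s' = #|B| by rewrite (perm_size ss').
have := @bicover_halving X Y (fun a b => r a b == c) A L s'; rewrite sizes' s'B.
move=> /(_ BL); apply: bicover_leq.
have {}tour : \sum_(a in A) flips [seq r a b == c | b <- s'] <= 2 * (k.-1 * #|A| * L.+1).
  apply: (@leq_trans (\sum_(a in A) flips (false :: map (r a) s'))).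
    by apply: leq_sum => a _; rewrite flips_map_eqb leq_addl.
  apply: (leq_trans tour); rewrite leq_mul2l /=.
  apply: leq_trans (sum_divn_dyadic _ L); apply: leq_sum => h _.
  exact: greedy_size.
rewrite big_split /= sum1_card -big_distrr /=.
apply: (@leq_trans (#|B| * L.+1 + (#|A| + 2 * L * (2 * (k.-1 * #|A| * L.+1))))).
  by rewrite !leq_add2l leq_mul2l tour orbT.
case: k k1 {rk k0 tour} => [|[|k]] //= _; move: #|A| #|B| => x y.
rewrite expnS expn1; nia.
Qed.

(** * Laminar families and convex orders *)

(** Induction on the list, smaller sets first: in an order for the tail, [S] is gathered into one
    block. Later sets contain [S] or miss it, so they stay convex. *)
Lemma exists_convex_order (X : finType) (l : seq {set X}) :
  pairwise (fun S T : {set X} => [disjoint S & T] || (S \subset T)) l ->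
  exists f : X -> nat, forall T, T \in l -> forall x y z, x \in T -> y \in T ->
    f x <= f z <= f y -> z \in T.
Proof.
elim: l => [|S l IH] /=; first by exists (fun=> 0).
move=> /andP[/allP Sl /IH[f fP]]; have [->|[s0 s0S]] := set_0Vmem S.
  by exists f => T; rewrite inE => /predU1P[-> x y z|/fP//]; rewrite inE.
(* [S] is contracted to the place of one of its points. *)
exists (fun z => if z \in S then 2 * f s0 else (2 * f z).+1) => T.
(* Only points of [S] have even rank, so nothing else falls between two of them. *)
rewrite inE => /predU1P[->|Tl] x y z xT yT.
  by rewrite xT yT; case: ifP => // _; lia.
pose c w := if w \in S then s0 else w.
have fc w : (if w \in S then 2 * f s0 else (2 * f w).+1)./2 = f (c w).
  by rewrite /c; case: ifP => _; lia.
move=> /andP[/half_leq xz /half_leq zy]; rewrite !fc in xz zy.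
have cT : {in T, forall w, c w \in T}.
  move=> w wT; rewrite /c; case: ifP => // wS.
  have /orP[/disjointFr/(_ wS)|/subsetP/(_ _ s0S)//] := Sl _ Tl.
  by rewrite wT.
have := fP _ Tl _ _ (c z) (cT _ xT) (cT _ yT); rewrite xz zy => /(_ isT).
rewrite /c; case: ifP => // zS s0T.
have /orP[/disjointFr/(_ s0S)|/subsetP/(_ _ zS)//] := Sl _ Tl.
by rewrite s0T.
Qed.

(** A convex set is entered and left at most once; starting inside it saves the entry. *)
Lemma flips_convex (T : eqType) (f : T -> nat) (P : pred T) s :
  pairwise (fun x y => f x <= f y) s ->
  {in s & &, forall x y z, P x -> P y -> f x <= f z <= f y -> P z} ->
  flips (map P s) <= (~~ head false (map P s)).+1.
Proof.
elim: s => // x s IH sorts convP.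
have := IH; have /= /andP[/allP xs sorts'] := sorts => /(_ sorts') {}IH.
have {}IH := IH (fun a b c as_ bs cs => convP a b c (mem_behead (s := x :: s) as_)
  (mem_behead (s := x :: s) bs) (mem_behead (s := x :: s) cs)).
case Px : (P x) => /=; last by move: IH; case: (map P s) => // -[] v /=; lia.
rewrite -/(map P (x :: s)) -[_ + _]/(flips (true :: map P s)) -Px -map_cons.
rewrite (leq_trans (flips_antitone _)) ?leq_b1 //.
apply/(pairwiseP false) => i j; rewrite !inE size_map => si sj ij.
rewrite !(nth_map x) //; apply/implyP => Pj.
have mi := mem_nth x si; have mj := mem_nth x sj.
apply: (convP x (nth x (x :: s) j) (nth x (x :: s) i)) => //; rewrite ?mem_head //.
have /(pairwiseP x) inc := sorts; rewrite (inc i j) // andbT.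
by case: i si {mi ij} => // i si; apply: (inc 0).
Qed.

(** For [k = 2], fibres with a common point are nested. Here [A] is ordered instead of [B], and each
    fibre flips at most twice, which leaves one logarithm. *)
Lemma semi2_bicover (X Y : finType) (r : X -> Y -> bool) c (A : {set X})
    (B : {set Y}) L :
  semi_eq 2 r -> #|A| + #|B| <= 2 ^ L ->
  bicover (fun a b => r a b == c) A B (5 * (#|A| + #|B|) * L.+1).
Proof.
move=> r2 ABL.
have [s [sB _ sorts]] := exists_sort_fib r A B leq_total leq_trans.
have lam : pairwise (fun S T : {set X} => [disjoint S & T] || (S \subset T)) (map (fib r A) s).
  rewrite pairwise_map; apply: sub_pairwise sorts => b b' /= bb'.
  rewrite -implyNb; apply/implyP => /pred0Pn[a /andP[/= ab ab']]; apply/negPn/negP => nbb'.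
  have : size [:: b; b'] < 2.
    apply: (semi_pairwise_incomparable (a := a) (A := A) r2) => /=.
      rewrite /incomparable nbb' !andbT; apply: contra nbb' => b'b.
      by have /eqP-> : fib r A b' == fib r A b by rewrite eqEcard b'b.
    by move: ab ab'; rewrite !inE => /andP[_ ->] /andP[_ ->].
  by [].
have [f fP] := exists_convex_order lam.
pose u := sort (fun x y => f x <= f y) (enum A).
have uA : [set a in u] = A by apply/setP => a; rewrite inE mem_sort mem_enum.
have sizeu : size u = #|A| by rewrite size_sort cardE.
have sortu : pairwise (fun x y => f x <= f y) u.
  rewrite -sorted_pairwise; last by move=> x y z; apply: leq_trans.
  by apply: sort_sorted => x y; apply: leq_total.
apply: bicover_tr.
have := @bicover_halving Y X (fun b a => r a b == c) B L u; rewrite sizeu uA.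
move=> /(_ (leq_trans (leq_addr _ _) ABL)); apply: bicover_leq.
apply: (@leq_trans (#|A| * L.+1 + \sum_(b in B) (1 + 2 * L * 2))); last first.
  by rewrite sum_nat_const; move: #|A| #|B| => x y; nia.
rewrite leq_add2l; apply: leq_sum => b bB; rewrite leq_add2l leq_mul2l.
apply/orP; right; rewrite flips_map_eqb.
apply: (leq_trans (flips_convex sortu _)); last by rewrite ltnS leq_b1.
have bs : fib r A b \in map (fib r A) s by apply: map_f; rewrite -sB inE in bB.
move=> x y z; rewrite !mem_sort !mem_enum => xA yA zA xb yb /(fP _ bs).
by rewrite !inE xA yA zA xb yb; apply.
Qed.

(** * Counting edges *)

(** Sizes at least [t] replace exactly [t], equivalently since bicliques can be shrunk. *)
Definition biclique_free t (X Y : finType) (E : X -> Y -> bool) (A : {set X})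
    (B : {set Y}) : Prop :=
  forall (A' : {set X}) (B' : {set Y}), A' \subset A -> B' \subset B ->
  (forall a b, a \in A' -> b \in B' -> E a b) -> t <= #|A'| -> #|B'| < t.

Definition edges (X Y : finType) (E : X -> Y -> bool) (A : {set X}) (B : {set Y}) :=
  \sum_(b in B) #|fib E A b|.

Lemma fib_subset (X Y : finType) (E : X -> Y -> bool) (A : {set X}) b :
  fib E A b \subset A.
Proof. by apply/subsetP => a; rewrite inE => /andP[]. Qed.

Lemma edgesE (X Y : finType) (E : X -> Y -> bool) (A : {set X}) (B : {set Y}) :
  edges E A B = \sum_a \sum_b ((a \in A) && (b \in B) && E a b : nat).
Proof.
rewrite /edges big_mkcond [RHS]exchange_big /=; apply: eq_bigr => b _.
case bB : (b \in B); last by rewrite big1 // => a _; rewrite andbF.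
rewrite -sum1_card big_mkcond; apply: eq_bigr => a _.
by rewrite inE andbT; case: (_ && _).
Qed.

Lemma edgesC (X Y : finType) (E : X -> Y -> bool) (A : {set X}) (B : {set Y}) :
  edges E A B = \sum_(a in A) #|[set b in B | E a b]|.
Proof.
rewrite edgesE [RHS]big_mkcond /=; apply: eq_bigr => a _.
case: (a \in A); last by rewrite big1.
by rewrite -sum1_card [RHS]big_mkcond; apply: eq_bigr => b _; rewrite inE /=; case: (_ && _).
Qed.

(** * Antichains and the linear bound for one literal *)

(** Pick a smallest set, discard its at most [d] supersets, and repeat: by minimality no remaining
    set lies below it. *)
Lemma exists_antichain (X Y : finType) (S : Y -> {set X}) d (N : {set Y}) :
  (forall b, b \in N -> #|[set c in N | S b \subset S c]| <= d) ->
  exists I, [/\ {subset I <= N}, pairwise (incomparable S) I & #|N| <= d * size I].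
Proof.
have [n] := ubnP #|N|; elim: n N => // n IH N Nn dN.
have [->|[b0 b0N]] := set_0Vmem N; first by exists [::]; split; rewrite ?cards0.
have [b /= bN bmin] := arg_minnP (fun b => #|S b|) (b0N : [pred b | b \in N] b0).
set U := [set c in N | S b \subset S c].
have UN : U \subset N by apply/subsetP => c; rewrite inE => /andP[].
have bU : b \in U by rewrite inE bN subxx.
have cardU : #|N :\: U| + #|U| = #|N| by rewrite addnC -(cardsID U N) (setIidPr UN).
have [||I [IN incI sizeI]] := IH (N :\: U).
- rewrite -ltnS; apply: leq_trans Nn; rewrite ltnS -cardU -addn1 leq_add2l card_gt0.
  by apply/set0Pn; exists b.
- move=> c; rewrite inE => /andP[_ /dN]; apply: leq_trans; apply: subset_leq_card.
  by apply/subsetP => e; rewrite !inE => /andP[/andP[_ ->] ->].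
exists (b :: I); split.
- by move=> c; rewrite inE => /predU1P[->//|/IN]; rewrite inE => /andP[].
- rewrite /= incI andbT; apply/allP => c /IN; rewrite !inE => /andP[nbc cN].
  rewrite cN /= in nbc; rewrite /incomparable nbc /=; apply: contra nbc => cb.
  by have /eqP-> : S c == S b by rewrite eqEcard cb bmin.
- by rewrite -cardU /= mulnS addnC leq_add // dN.
Qed.

(** A fibre with at least [t] points forms a biclique with all parameters whose fibres contain
    it. *)
Lemma biclique_free_up t (X Y : finType) (E : X -> Y -> bool) (A : {set X})
    (B N : {set Y}) b :
  biclique_free t E A B -> N \subset B -> t <= #|fib E A b| ->
  #|[set c in N | fib E A b \subset fib E A c]| <= t.
Proof.
move=> Ef /subsetP NB tb; apply: ltnW.
apply: (Ef _ _ (fib_subset E A b)) => //.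
  by apply/subsetP => c; rewrite inE => /andP[/NB].
by move=> a c ab; rewrite inE => /andP[_ /subsetP/(_ _ ab)]; rewrite inE => /andP[].
Qed.

Lemma edges_large_fib t (X Y : finType) (E : X -> Y -> bool) (A : {set X}) (B : {set Y}) :
  edges E A B <= t * #|B| + edges E A [set b in B | t <= #|fib E A b|].
Proof.
rewrite /edges (bigID (fun b => t <= #|fib E A b|)) /= addnC leq_add //.
  rewrite mulnC -sum_nat_const [leqRHS](bigID (fun b => t <= #|fib E A b|)) /=.
  rewrite (leq_trans _ (leq_addl _ _)) //; apply: leq_sum => b /andP[_].
  by rewrite -ltnNge => /ltnW.
by rewrite [leqRHS](eq_bigl (fun b => (b \in B) && (t <= #|fib E A b|))) // => b; rewrite inE.
Qed.

(** Among the large fibres through a point, an antichain has fewer than [k] members, and each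
    accounts for at most [t] fibres. *)
Lemma edges_semi_pos k t (X Y : finType) (r : X -> Y -> bool) (A : {set X}) (B : {set Y}) :
  semi_eq k r -> biclique_free t r A B ->
  edges r A B <= t * #|B| + t * k * #|A|.
Proof.
move=> rk rf; apply: (leq_trans (edges_large_fib t _ _ _)).
rewrite leq_add2l edgesC [leqRHS]mulnC -sum_nat_const; apply: leq_sum => a _.
set N := [set b in _ | _].
have [|I [IN incI]] := @exists_antichain _ _ (fib r A) t N.
  move=> b; rewrite !inE => /andP[/andP[_ tb] _]; apply: (biclique_free_up rf) => //.
  by apply/subsetP => c; rewrite !inE => /andP[/andP[]].
move=> /leq_trans; apply; rewrite leq_mul2l ltnW ?orbT //.
apply: (semi_pairwise_incomparable rk incI (a := a)).
by apply/allP => b /IN; rewrite inE => /andP[].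
Qed.

(** Cut [k] blocks of [t] parameters from [I]. Fewer than [t] points miss a whole block, and any
    other point meets a fibre of every block. *)
Lemma biclique_free_count t k (X Y : finType) (r : X -> Y -> bool) (A : {set X})
    (B : {set Y}) I :
  0 < t -> biclique_free t (fun a b => r a b == false) A B -> uniq I -> {subset I <= B} ->
  k * t <= size I -> #|[set a in A | count (r a) I < k]| <= k * t.-1.
Proof.
move=> t0 rf; elim: k I => [|k IH] I uI IB sI.
  rewrite mul0n leqn0 cards_eq0; apply/eqP/setP => a; rewrite !inE ltn0 andbF //.
have tI : t <= size I by apply: leq_trans sI; rewrite mulSn leq_addr.
have uI' := uI; rewrite -(cat_take_drop t I) cat_uniq in uI'.
have /and3P[ut _ ud] := uI'.
have {}IH := IH (drop t I) ud (fun b bI => IB b (mem_drop bI)).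
have {}IH : #|[set a in A | count (r a) (drop t I) < k]| <= k * t.-1.
  by apply: IH; rewrite size_drop; move: sI; rewrite mulSn; lia.
pose Z := [set a in A | count (r a) (take t I) == 0].
have Zt : #|Z| <= t.-1.
  rewrite -ltnS prednK // ltnNge; apply/negP => tZ.
  have : #|[set b in take t I]| < t.
    apply: (rf Z) => //.
    - by apply/subsetP => a; rewrite inE => /andP[].
    - by apply/subsetP => b; rewrite inE => /mem_take/IB.
    - move=> a b; rewrite !inE => /andP[_]; rewrite -leqn0 leqNgt -has_count => /hasPn nr.
      by move=> /nr/negPf->.
  by rewrite cardsE (card_uniqP ut) size_take_min (minn_idPl tI) ltnn.
rewrite mulSn; apply: leq_trans (leq_add Zt IH).
apply: leq_trans (leq_card_setU _ _); apply: subset_leq_card; apply/subsetP => a.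
rewrite !inE -{1}(cat_take_drop t I) count_cat => /andP[->] /=.
by move: (count _ _) (count _ _) => x y; lia.
Qed.

Lemma edges_semi_neg k t (X Y : finType) (r : X -> Y -> bool) (A : {set X}) (B : {set Y}) :
  0 < k -> 0 < t -> semi_eq k r -> biclique_free t (fun a b => r a b == false) A B ->
  edges (fun a b => r a b == false) A B <= k * t * #|B| + t * (k * t) * #|A|.
Proof.
move=> k0 t0 rk rf; set E := (fun a b => _) in rf *.
have leA b : #|fib E A b| <= #|A| by apply: subset_leq_card; apply: fib_subset.
(* If [A] is small, so are all fibres. Otherwise the number of large fibres is bounded by a
   constant: [k * t] incomparable ones would leave a point of [A] in [k] fibres of [r]. *)
have [Akt|ktA] := leqP #|A| (k * t).
  apply: leq_trans (leq_addr _ _); rewrite /edges mulnC -sum_nat_const.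
  by apply: leq_sum => b _; apply: leq_trans Akt.
apply: (leq_trans (edges_large_fib t _ _ _)); apply: leq_add.
  by rewrite leq_mul2r leq_pmull // orbT.
set N := [set b in B | _].
have NB : N \subset B by apply/subsetP => b; rewrite inE => /andP[].
have [|I [IN incI sizeI]] := @exists_antichain _ _ (fib E A) t N.
  by move=> b; rewrite inE => /andP[_ tb]; apply: (biclique_free_up rf).
apply: (@leq_trans (#|N| * #|A|)).
  by rewrite /edges -sum_nat_const; apply: leq_sum.
rewrite leq_mul2r (leq_trans sizeI) ?orbT // leq_mul2l; apply/orP; right.
rewrite leqNgt; apply/negP => /ltnW ktI.
(* Complementing within [A] reverses inclusion and so preserves incomparability. *)
have fibE b c : (fib E A b \subset fib E A c) = (fib r A c \subset fib r A b).
  apply/subsetP/subsetP => sub a; have := sub a; rewrite !inE /E; case: (a \in A) => //=;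
  by case: (r a b) (r a c) => [] [] // /(_ isT).
have {}incI : pairwise (incomparable (fib r A)) I.
  by move: incI; apply: sub_pairwise => b c; rewrite /incomparable !fibE andbC.
have uI : uniq I.
  by apply: pairwise_uniq incI => b; rewrite /incomparable subxx.
have := biclique_free_count t0 rf uI (fun b bI => subsetP NB b (IN b bI)) ktI.
rewrite leqNgt => /negP; apply.
apply: (@leq_trans #|A|); first by apply: leq_trans ktA; rewrite ltnS leq_mul2l leq_pred orbT.
apply: subset_leq_card; apply/subsetP => a aA; rewrite inE aA -size_filter.
apply: (semi_pairwise_incomparable rk _ (filter_all _ _)).
exact: subseq_pairwise (filter_subseq _ _) incI.
Qed.

(** * Induction on the number of literals *)

Definition conj_literals (X Y : finType) (r : nat -> X -> Y -> bool) (c : nat -> bool)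
    (m : nat) (a : X) (b : Y) := all (fun i => r i a b == c i) (iota 0 m).

Lemma conj_literalsS (X Y : finType) (r : nat -> X -> Y -> bool) c m a b :
  conj_literals r c m.+1 a b = (r m a b == c m) && conj_literals r c m a b.
Proof. by rewrite /conj_literals -addn1 iotaD all_cat /= add0n andbT andbC. Qed.

(** On each rectangle [E] and [E'] agree, so [E] inherits biclique-freeness there; overlaps only
    overcount. *)
Lemma edges_bicover (X Y : finType) (P E E' : X -> Y -> bool) (A : {set X})
    (B : {set Y}) t w K :
  (forall a b, E' a b = P a b && E a b) -> bicover P A B w ->
  (forall (A' : {set X}) (B' : {set Y}), A' \subset A -> B' \subset B -> biclique_free t E A' B' ->
    edges E A' B' <= K * (#|A'| + #|B'|)) ->
  biclique_free t E' A B -> edges E' A B <= K * w.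
Proof.
move=> EE' [cv [cvP Pcv wcv]] EK E'f.
apply: (@leq_trans (\sum_(p <- cv) edges E p.1 p.2)); last first.
  apply: (@leq_trans (K * \sum_(p <- cv) (#|p.1| + #|p.2|))); last by rewrite leq_mul2l wcv orbT.
  rewrite big_distrr big_seq [leqRHS]big_seq /=; apply: leq_sum => p /cvP[pA pB pP].
  apply: EK => // A' B' A'p B'p EA'B'; apply: E'f.
  - exact: subset_trans pA.
  - exact: subset_trans pB.
  - move=> a b aA' bB'; rewrite EE' EA'B' // andbT.
    by apply: pP; [apply: (subsetP A'p)|apply: (subsetP B'p)].
rewrite edgesE; under [leqRHS]eq_bigr => p _ do rewrite edgesE.
rewrite [leqRHS]exchange_big; apply: leq_sum => a _.
rewrite [leqRHS]exchange_big; apply: leq_sum => b _.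
have [/andP[/andP[aA bB]]|//] := boolP ((a \in A) && (b \in B) && E' a b).
rewrite EE' => /andP[Pab Eab]; have [p pcv /andP[ap bp]] := Pcv a b aA bB Pab.
by rewrite (big_rem p) //= ap bp Eab.
Qed.

(** As [L] is only an upper bound for the logarithm, one [L] serves all smaller rectangles, and each
    peeled literal contributes one power of [L.+1]. *)
Lemma edges_conj_literals k t m : 1 < k -> 0 < t ->
  exists C, forall (X Y : finType) (r : nat -> X -> Y -> bool) (c : nat -> bool),
  (forall i, semi_eq k (r i)) -> forall L (A : {set X}) (B : {set Y}),
  #|A| + #|B| <= 2 ^ L -> biclique_free t (conj_literals r c m.+1) A B ->
  edges (conj_literals r c m.+1) A B <=
  C * L.+1 ^ (m * minn (k - 1) 2) * (#|A| + #|B|).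
Proof.
move=> k1 t0; have k0 := ltnW k1; elim: m => [|m [C IH]].
  exists (t * k * t) => X Y r c rk L A B _; rewrite mul0n expn0 muln1.
  have conj1 a b : conj_literals r c 1 a b = (r 0 a b == c 0).
    by rewrite conj_literalsS andbT.
  have -> : edges (conj_literals r c 1) A B = edges (fun a b => r 0 a b == c 0) A B.
    apply: eq_bigr => b _; congr #|pred_of_set _|.
    by apply/setP => a; rewrite !inE conj1.
  move=> cf; have {conj1} : biclique_free t (fun a b => r 0 a b == c 0) A B.
    move=> A' B' A'A B'B AB; apply: cf => // a b aA' bB'.
    by rewrite conj1; apply: AB.
  case: (c 0) => rf; last first.
    apply: (leq_trans (edges_semi_neg k0 t0 (rk 0) rf)).
    rewrite mulnDr addnC leq_add //; first by rewrite mulnA.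
    by rewrite leq_mul2r -[t * k * t]mulnA leq_pmull // orbT.
  have -> : edges (fun a b => r 0 a b == true) A B = edges (r 0) A B.
    apply: eq_bigr => b _; congr #|pred_of_set _|.
    by apply/setP => a; rewrite !inE eqb_id.
  have {}rf : biclique_free t (r 0) A B.
    move=> A' B' A'A B'B AB; apply: rf => // a b aA' bB'.
    by rewrite eqb_id; apply: AB.
  apply: (leq_trans (edges_semi_pos (rk 0) rf)).
  rewrite mulnDr addnC leq_add // leq_mul2r; apply/orP; right; first exact: leq_pmulr.
  by rewrite -mulnA leq_pmulr // muln_gt0 k0.
pose al := minn (k - 1) 2.
(* The factor [5 * k] dominates both cover constants, [5] for [k = 2] and [4 * k] in general. *)
exists (C * (5 * k)) => X Y r c rk L A B ABL cf.
have cover : bicover (fun a b => r m.+1 a b == c m.+1) A B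
    (5 * k * (#|A| + #|B|) * L.+1 ^ al).
  have [k2|k2] := leqP k 2.
    have {k2} k2 : k = 2 by lia.
    have r2 : semi_eq 2 (r m.+1) by rewrite -k2.
    apply: bicover_leq (semi2_bicover _ r2 ABL).
    by rewrite /al k2 expn1 !leq_mul2r !orbT.
  have -> : al = 2 by rewrite /al; lia.
  apply: bicover_leq (semi_bicover _ k1 (rk m.+1) ABL).
  by rewrite !leq_mul2r; lia.
have := @edges_bicover _ _ _ _ _ A B t _ (C * L.+1 ^ (m * al)) (conj_literalsS r c m.+1) cover.
move=> /(_ _ cf) edgesC; apply: (leq_trans (edgesC _)).
  move=> A' B' A'A B'B; apply: IH => //.
  by apply: leq_trans ABL; apply: leq_add; apply: subset_leq_card.
rewrite -/al mulSn expnD; apply: eq_leq.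
move: (L.+1 ^ al) (L.+1 ^ (m * al)) (#|A| + #|B|) => u v n.
lia.
Qed.

(** The relation is the union of one conjunction of literals per accepted truth vector; each is a
    subrelation, hence biclique-free, and there are at most [2 ^ m.+1]. *)
Lemma edges_boolean_combination k t m : 1 < k -> 0 < t ->
  exists C, forall (X Y : finType) (r : 'I_m.+1 -> X -> Y -> bool)
      (Psi : m.+1.-tuple bool -> bool),
  (forall i, semi_eq k (r i)) -> forall L (A : {set X}) (B : {set Y}),
  #|A| + #|B| <= 2 ^ L ->
  biclique_free t (fun a b => Psi [tuple r i a b | i < m.+1]) A B ->
  edges (fun a b => Psi [tuple r i a b | i < m.+1]) A B <=
  C * L.+1 ^ (m * minn (k - 1) 2) * (#|A| + #|B|).
Proof.
move=> k1 t0; have [C bound] := edges_conj_literals m k1 t0.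
exists (2 ^ m.+1 * C) => X Y r Psi rk L A B ABL Psif.
(* Beyond [m], [inord] falls back to a default index, so every [r' i] is a semi-equation. *)
pose r' i : X -> Y -> bool := r (inord i).
pose lit (v : m.+1.-tuple bool) := conj_literals r' (fun i => tnth v (inord i)) m.+1.
have litP v a b : lit v a b = (v == [tuple r i a b | i < m.+1]).
  apply/allP/eqP => [vab|-> i]; last by rewrite tnth_mktuple.
  apply: eq_from_tnth => i; rewrite tnth_mktuple.
  have := vab (val i); rewrite mem_iota ltn_ord /r' inord_val.
  by move=> /(_ isT)/eqP.
apply: (@leq_trans (\sum_(v | Psi v) edges (lit v) A B)).
  rewrite edgesE; under [leqRHS]eq_bigr => v _ do rewrite edgesE.
  rewrite [leqRHS]exchange_big; apply: leq_sum => a _.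
  rewrite [leqRHS]exchange_big; apply: leq_sum => b _.
  have [/andP[ab Psiab]|//] := boolP (_ && _).
  by rewrite (bigD1 [tuple r i a b | i < m.+1]) //= litP eqxx ab.
apply: (@leq_trans (\sum_(v : m.+1.-tuple bool)
    C * L.+1 ^ (m * minn (k - 1) 2) * (#|A| + #|B|))); last first.
  by rewrite sum_nat_const card_tuple card_bool !mulnA.
rewrite big_mkcond; apply: leq_sum => v _; case: ifP => // Psiv.
apply: bound => // [i|]; first exact: rk.
move=> A' B' A'A B'B AB; apply: Psif => // a b aA' bB'.
by have := AB _ _ aA' bB'; rewrite -/(lit v) litP => /eqP<-.
Qed.

(** * Formulas and real bounds *)

From mathcomp Require Import all_order all_algebra finmap.
From mathcomp Require Import all_classical all_reals all_analysis.
Import Order.TTheory GRing.Theory Num.Theory.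
Local Open Scope classical_set_scope.
Local Open Scope ring_scope.

Lemma exists_subset_card (T : choiceType) (F : {fset T}) (A : {set F}) t :
  (t <= #|A|)%N -> exists S : set T, (S #= `I_t)%card /\
    forall x, S x -> exists2 a : F, a \in A & val a = x.
Proof.
move=> tA; pose s := take t (map val (enum A)).
exists [set` [fset x in s]%fset]; split.
  apply/card_eq_fsetP; rewrite card_fseq undup_id.
    by rewrite size_take_min size_map -cardE (minn_idPl tA).
  by rewrite take_uniq // map_inj_uniq ?enum_uniq //; apply: val_inj.
move=> x /=; rewrite !inE => /mem_take/mapP[a]; rewrite mem_enum => aA ->.
by exists a.
Qed.

Lemma ncard_bool_edges_leq k t m : (1 < k)%N -> (0 < t)%N ->
  exists C : nat, forall (L : language) (M : structure L) (p q : nat)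
    (phi : 'I_m.+1 -> pformula L p q) (Psi : m.+1.-tuple bool -> bool),
  (forall i, semi_equation k M (phi i)) ->
  forall (V : set (p.-tuple M)) (W : set (q.-tuple M)),
  finite_set V -> finite_set W ->
  Ktt_free t V W (bool_edges phi Psi V W) ->
  forall l, (ncard V + ncard W <= 2 ^ l)%N ->
  (ncard (bool_edges phi Psi V W) <=
   C * l.+1 ^ (m * minn (k - 1) 2) * (ncard V + ncard W))%N.
Proof.
move=> k1 t0; have [C bound] := edges_boolean_combination m k1 t0.
exists C => L M p q phi Psi phik V W finV finW Ef l.
set E := bool_edges _ _ _ _ in Ef *.
pose FV := fset_set (V : set {classic p.-tuple M}).
pose FW := fset_set (W : set {classic q.-tuple M}).
have FVP (a : FV) : V (val a).
  by have := valP a; rewrite in_fset_set // inE.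
have FWP (b : FW) : W (val b).
  by have := valP b; rewrite in_fset_set // inE.
pose r i (a : FV) (b : FW) := `[< psat (phi i) (val a) (val b) >].
(* An inclusion between fibres over all of [M] restricts to the finite set [V]. *)
have rk i : semi_eq k (r i).
  move=> b a rab; have [|i1 [i2 [i12 sub]]] := phik i (fun j => val (b j)).
    by exists (val a) => j; apply/asboolP; apply: rab.
  by exists i1, i2; split => // a' /asboolP a'b; apply/asboolP; apply: sub.
pose F a b := Psi [tuple r i a b | i < m.+1].
have FE a b : F a b -> E (val a, val b) by move=> Fab; split; [exact: FVP|exact: FWP|].
have cardV : ncard V = #|[set: FV]%SET| by rewrite cardsT /ncard cardfE.
have cardW : ncard W = #|[set: FW]%SET| by rewrite cardsT /ncard cardfE.
rewrite cardV cardW => sizel.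
apply: (leq_trans _ (bound _ _ r Psi rk l _ _ sizel _)).
  rewrite edgesE pair_bigA /=.
  pose f (x : FV * FW) : {classic p.-tuple M * q.-tuple M} := (val x.1, val x.2).
  pose G := [fset f x | x in [pred x : FV * FW | F x.1 x.2]]%fset.
  apply: (@leq_trans #|` G|).
    apply: fsubset_leq_card; apply/fsubsetP => x.
    have finE : finite_set (E : set {classic p.-tuple M * q.-tuple M}).
      by apply: sub_finite_set (finite_setX finV finW) => -[a b] [].
    rewrite in_fset_set // inE => -[Vx Wx Psix].
    have xV : (x.1 : {classic p.-tuple M}) \in FV by rewrite /FV /FW in_fset_set // inE.
    have xW : (x.2 : {classic q.-tuple M}) \in FW by rewrite /FV /FW in_fset_set // inE.
    apply/imfsetP; exists ([` xV]%fset, [` xW]%fset) => //=.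
    exact: surjective_pairing.
  apply: (leq_trans (leq_imfset_card _ _ _)).
  rewrite -cardE -sum1_card big_mkcond; apply: leq_sum => x _.
  by rewrite !inE unfold_in /=; case: ifP => //; rewrite /F => ->.
(* A biclique with both sides at least [t] is cut down to a forbidden one of size exactly [t]. *)
move=> A B _ _ AB tA; rewrite ltnNge; apply/negP => tB; apply: Ef.
have [A' [cA A'A]] := exists_subset_card tA.
have [B' [cB B'B]] := exists_subset_card tB.
exists A', B'; split => //.
- by move=> x /A'A[a _ <-].
- by move=> x /B'B[b _ <-].
- move=> [x y] [/= /A'A[a aA <-] /B'B[b bB <-]].
  by apply: FE; apply: AB.
Qed.

Lemma trunc_log2_leq_ln (R : realType) (n : nat) :
  ((trunc_log 2 n).+2)%:R <= (2 + (ln 2)^-1) * (1 + ln (1 + n%:R)) :> R.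
Proof.
have ln2 : 0 < ln 2 :> R by apply: ln_gt0; rewrite ltr1n.
have lnn : 0 <= ln (1 + n%:R) :> R by apply: ln_ge0; rewrite lerDl ler0n.
have : (trunc_log 2 n)%:R * ln 2 <= ln (1 + n%:R) :> R.
  rewrite mulrC mulr_natr -lnXn ?ltr0n // ler_ln ?posrE ?exprn_gt0 ?ltr_wpDr ?ler0n //.
  (* At [n = 0] the truncated logarithm is [0] by convention. *)
  rewrite -natrX; case: n {lnn} => [|n]; first by rewrite trunc_log0 addr0.
  by apply: ler_wpDl => //; rewrite ler_nat trunc_logP.
rewrite -ler_pdivlMr // => /le_trans le_t.
rewrite -addn2 natrD mulrDl addrC lerD //; first by rewrite ler_peMr // lerDl.
apply: le_t; rewrite mulrC; apply: ler_wpM2l; first by rewrite invr_ge0 ltW.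
by rewrite lerDr.
Qed.

Theorem corollary1p1 (R : realType) (k t m : nat)
    (hk : (2 <= k)%N) (ht : (2 <= t)%N) (hm : (1 <= m)%N) :
  exists C : R,
    forall (L : language) (M : structure L) (p q : nat)
      (phi : 'I_m -> pformula L p q) (Psi : m.-tuple bool -> bool),
    (forall i : 'I_m, semi_equation k M (phi i)) ->
    forall (V : set (p.-tuple M)) (W : set (q.-tuple M)),
    finite_set V -> finite_set W ->
    let n := (ncard V + ncard W)%N in
    let alpha := minn (k - 1) 2 in
    let E := bool_edges phi Psi V W in
    Ktt_free t V W E ->
    (ncard E)%:R <= C * (n%:R * (1 + ln (1 + n%:R)) ^+ ((m - 1) * alpha)) /\
    (m = 1%N -> (ncard E)%:R <= C * n%:R).
Proof.
case: m hm => // m _; have [C bound] := ncard_bool_edges_leq m hk (ltnW ht).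
set e := (m * minn (k - 1) 2)%N in bound.
exists (C%:R * (2 + (ln 2)^-1) ^+ e) => L M p q phi Psi phik V W finV finW n alpha E Ef.
have nE : (ncard E)%:R <=
    C%:R * (2 + (ln 2)^-1) ^+ e * (n%:R * (1 + ln (1 + n%:R)) ^+ ((m.+1 - 1) * alpha)) :> R.
  (* Taking [l] as the truncated logarithm plus one ensures [n <= 2 ^ l], so [l.+1] is the quantity
     compared with [ln]. *)
  have := bound _ _ _ _ _ _ phik _ _ finV finW Ef _ (ltnW (@trunc_log_ltn 2 n isT)).
  rewrite -/n -(ler_nat R) => /le_trans; apply.
  rewrite !natrM natrX subn1 [n%:R * _]mulrC mulrA ler_wpM2r ?ler0n //.
  rewrite -mulrA ler_wpM2l ?ler0n // -exprMn; have := trunc_log2_leq_ln R n.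
  by move=> le_t; rewrite lerXn2r ?nnegrE ?ler0n ?(le_trans _ le_t) ?ler0n.
split=> // m1; move: nE; case: m1 => ->; rewrite subnn mul0n expr0 mulr1.
by [].
Qed.
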